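(* Let $\mathbb Y$ be a Banach space with $\dim\mathbb Y\ge2$ and $\mathbb M\subset\mathbb Y$ a closed subspace. Suppose $y_0\in\mathbb M$ is a best approximation in $\mathbb M$ of a given $y\in\mathbb Y$, i.e. $\|y-y_0\|_{\mathbb Y}\le\|y-z_0\|_{\mathbb Y}$ for all $z_0\in\mathbb M$. Then $$\|y_0\|_{\mathbb Y}\le C_{\mathrm{BM}}(\mathbb Y)\,\|y\|_{\mathbb Y},$$ where $C_{\mathrm{BM}}(\mathbb Y)$ is the Banach--Mazur constant of $\mathbb Y$.
   Context: All spaces are real. Banach--Mazur constant (for $\dim\mathbb Y\ge2$): $C_{\mathrm{BM}}(\mathbb Y):=\sup\{d_{\mathrm{BM}}(\mathbb W,\ell_2(\mathbb R^2))^2:\mathbb W\subset\mathbb Y\text{ a subspace},\ \dim\mathbb W=2\}$, where $d_{\mathrm{BM}}(\mathbb W,\ell_2(\mathbb R^2)):=\inf\{\|T\|\,\|T^{-1}\|: T:\mathbb W\to\ell_2(\mathbb R^2)\text{ a linear isomorphism}\}$ and $\ell_2(\mathbb R^2)$ is $\mathbb R^2$ with the Euclidean norm. It is known that $1\le C_{\mathrm{BM}}(\mathbb Y)\le2$. *)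

(* Defs.v *)
From HB Require Import structures.
From mathcomp Require Import all_boot all_order all_algebra.
From mathcomp Require Import all_classical all_reals all_analysis.

Set Implicit Arguments.
Unset Strict Implicit.
Unset Printing Implicit Defensive.

Import Order.TTheory GRing.Theory Num.Theory.
Import numFieldNormedType.Exports.

Local Open Scope classical_set_scope.
Local Open Scope ring_scope.

Definition lin_indep2 (R : realType) (V : lmodType R) (u v : V) : Prop :=
  forall a b : R, a *: u + b *: v = 0 -> a = 0 /\ b = 0.

Definition dim_ge2 (R : realType) (V : lmodType R) : Prop :=
  exists u v : V, lin_indep2 u v.

Definition is_subspace (R : realType) (V : lmodType R) (W : set V) : Prop :=
  submod_closed (mem W).

Definition dim_eq2 (R : realType) (V : lmodType R) (W : set V) : Prop :=
  exists u v : V, [/\ W u, W v, lin_indep2 u v &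
    forall w, W w -> exists a b : R, w = a *: u + b *: v].

(* The canonical norm of 'rV[R]_2 is the sup norm, hence an explicit one. *)
Definition l2norm (R : realType) (v : 'rV[R]_2) : R :=
  Num.sqrt (\sum_i v ord0 i ^+ 2).

(* Norm of the restriction to A of f, for the norms nU and nV; it is +oo if
   that restriction is unbounded. *)
Definition opnorm (R : realType) (U V : Type) (nU : U -> R) (nV : V -> R)
    (A : set U) (f : U -> V) : \bar R :=
  ereal_sup [set (nV (f x))%:E | x in [set x | A x /\ nU x <= 1]].

(* T restricts to a linear isomorphism from W onto R^2, with inverse S; the
   values of T outside W are irrelevant. *)
Definition lin_iso_l2 (R : realType) (Y : lmodType R) (W : set Y)
    (T : Y -> 'rV[R]_2) (S : 'rV[R]_2 -> Y) : Prop :=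
  [/\ forall (a : R) u v, W u -> W v -> T (a *: u + v) = a *: T u + T v,
      forall x, W (S x),
      forall w, W w -> S (T w) = w &
      forall x, T (S x) = x].

Definition dBM_l2 (R : realType) (Y : normedModType R) (W : set Y) : \bar R :=
  ereal_inf [set d | exists T S, lin_iso_l2 W T S /\
    d = (opnorm (@Num.norm R Y) (@l2norm R) W T *
         opnorm (@l2norm R) (@Num.norm R Y) setT S)%E].

(* The values are extended reals so that the supremum exists without first
   proving that it is finite. *)
Definition CBM (R : realType) (Y : normedModType R) : \bar R :=
  ereal_sup [set (dBM_l2 W ^+ 2)%E | W in
    [set W : set Y | is_subspace W /\ dim_eq2 W]].

Definition best_approx (R : realType) (Y : normedModType R) (M : set Y)
    (y y0 : Y) : Prop :=
  M y0 /\ forall z0, M z0 -> `|y - y0| <= `|y - z0|.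

(* Main.v *)
(** Put [v = y - y0] and let [T] identify the plane spanned by [y] and [y0] with
    the Euclidean plane, at the cost of a distortion [d].  Since [v] is no longer
    than [y - t y0] for every [t], the Euclidean length of [T v] is at most [d]
    times the distance [h] from [T y] to the line through [T y0].  Up to a factor
    2, the triangle with vertices [0], [T y0], [T y] has area [h * |T y0|], which
    is at most [|T v| * |T y|]; hence [|T y0| <= d * |T y|], and returning to [Y]
    costs another factor [d]. *)
Require Import Defs.
From mathcomp Require Import all_boot all_order all_algebra.
From mathcomp Require Import all_classical all_reals all_analysis.
From mathcomp Require Import ring.

Set Implicit Arguments.
Unset Strict Implicit.
Unset Printing Implicit Defensive.

Import Order.TTheory GRing.Theory Num.Theory.
Import numFieldNormedType.Exports.

Local Open Scope classical_set_scope.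
Local Open Scope ring_scope.

Lemma is_subspaceP (R : realType) (V : lmodType R) (W : set V) :
  is_subspace W <-> W 0 /\ forall a u v, W u -> W v -> W (a *: u + v).
Proof.
split=> [[W0 WD]|[W0 WD]].
  split=> [|a u v Wu Wv]; first exact: set_mem W0.
  by apply: set_mem; apply: WD; apply: mem_set.
split=> [|a u v Wu Wv]; first exact: mem_set.
by apply: mem_set; apply: WD; apply: set_mem.
Qed.

(** * Lengths and areas in the Euclidean plane *)

Section EuclideanPlane.
Context {R : realType}.
Implicit Types (p q : 'rV[R]_2) (a : R).

Lemma l2norm_ge0 p : 0 <= l2norm p.
Proof. exact: sqrtr_ge0. Qed.

Lemma l2norm_sqr p : l2norm p ^+ 2 = p ord0 ord0 ^+ 2 + p ord0 ord_max ^+ 2.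
Proof.
rewrite sqr_sqrtr; last by apply: sumr_ge0 => i _; exact: sqr_ge0.
rewrite big_ord_recr big_ord1 /=.
by congr (p _ _ ^+ 2 + _); apply: val_inj.
Qed.

Lemma l2normZ a p : l2norm (a *: p) = `|a| * l2norm p.
Proof.
apply: (@pexpIrn _ 2) => //; rewrite ?nnegrE ?mulr_ge0 ?l2norm_ge0 //.
rewrite exprMn real_normK ?num_real // !l2norm_sqr !mxE; ring.
Qed.

Lemma l2norm_eq0 p : l2norm p = 0 -> p = 0.
Proof.
move=> p0; have := l2norm_sqr p; rewrite p0 expr0n /= => /esym/eqP.
rewrite paddr_eq0 ?sqr_ge0 // !sqrf_eq0 => /andP[/eqP p00 /eqP p01].
apply/rowP => i; rewrite mxE.
case: i => [[|[|//]]] i2.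
  by rewrite -[RHS]p00; congr (p _ _); apply: val_inj.
by rewrite -[RHS]p01; congr (p _ _); apply: val_inj.
Qed.

(* Both sides bound the area of the parallelogram spanned by [p] and [q]: the
   left one attains it, for [q - t *: p] the component of [q] orthogonal to [p]. *)
Lemma l2norm_height_le p q : p != 0 ->
  exists t, l2norm (q - t *: p) * l2norm p <= l2norm (q - p) * l2norm q.
Proof.
move=> p0.
have n0 : l2norm p ^+ 2 != 0.
  by rewrite sqrf_eq0; apply: contra_neq p0; exact: l2norm_eq0.
move: n0; rewrite l2norm_sqr; set x := p _ _; set y := p _ _ => n0.
set z := q ord0 ord0; set w := q ord0 ord_max.
(* The coefficient of the orthogonal projection of [q] onto [p]. *)
exists ((x * z + y * w) / (x ^+ 2 + y ^+ 2)).
rewrite -(@ler_pXn2r _ 2) ?nnegrE ?mulr_ge0 ?l2norm_ge0 //.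
rewrite !exprMn !l2norm_sqr !mxE -/x -/y -/z -/w.
set t := (_ / _).
have -> : ((z - t * x) ^+ 2 + (w - t * y) ^+ 2) * (x ^+ 2 + y ^+ 2) =
  (x * w - y * z) ^+ 2 by rewrite /t; field.
rewrite -subr_ge0.
(* Lagrange's identity for [q - p] and [q], whose determinant is, up to sign, that of [p] and
   [q]. *)
have -> : ((z - x) ^+ 2 + (w - y) ^+ 2) * (z ^+ 2 + w ^+ 2) -
   (x * w - y * z) ^+ 2 = ((z - x) * z + (w - y) * w) ^+ 2 by ring.
exact: sqr_ge0.
Qed.

End EuclideanPlane.

(** * Operator norms of homogeneous maps *)

Section OperatorNorm.
Context {R : realType} {U V : lmodType R}.
Variables (nU : U -> R) (nV : V -> R) (A : set U) (f : U -> V).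
Hypothesis nU_ge0 : forall x, 0 <= nU x.
Hypothesis nU_eq0 : forall x, nU x = 0 -> x = 0.
Hypothesis nUZ : forall a x, nU (a *: x) = `|a| * nU x.
Hypothesis nVZ : forall a x, nV (a *: x) = `|a| * nV x.
Hypothesis AZ : forall a x, A x -> A (a *: x).
Hypothesis fZ : forall a x, A x -> f (a *: x) = a *: f x.

(** Rescaling [x] to length 1 puts it in the set over which the supremum runs. If [nU x = 0], both
    sides vanish, even for an infinite operator norm, since [+oo * 0 = 0]. *)
Lemma le_opnorm x : A x -> ((nV (f x))%:E <= opnorm nU nV A f * (nU x)%:E)%E.
Proof.
move=> Ax; have [/nU_eq0 x0|nx0] := eqVneq (nU x) 0.
  have -> : x = 0 *: x by rewrite scale0r.
  by rewrite fZ // nUZ nVZ normr0 !mul0r mule0.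
have nx : 0 < nU x by rewrite lt_def nx0 nU_ge0.
rewrite -lee_pdivrMr // -EFinM; apply: ereal_sup_ubound.
exists ((nU x)^-1 *: x) => /=.
  by split; [exact: AZ|rewrite nUZ gtr0_norm ?invr_gt0 // mulVf].
by rewrite fZ // nVZ gtr0_norm ?invr_gt0 // mulrC.
Qed.

(** Positivity keeps a product of two operator norms away from [0 * +oo], so that one infinite
    factor makes it infinite. *)
Lemma opnorm_gt0 x : A x -> 0 < nV (f x) -> (0 < opnorm nU nV A f)%E.
Proof.
move=> Ax fx; rewrite ltNge; apply/negP => o0.
have := le_opnorm Ax; rewrite leNgt => /negP; apply.
apply: (@le_lt_trans _ _ 0%E); last by rewrite lte_fin.
by apply: mule_le0_ge0; rewrite ?lee_fin.
Qed.

End OperatorNorm.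

(** * Estimates for one fixed isomorphism onto the Euclidean plane *)

Section Distortion.
Context {R : realType} {Y : normedModType R}.
Implicit Types (W : set Y) (T : Y -> 'rV[R]_2) (S : 'rV[R]_2 -> Y).

Definition distortion W T S : \bar R :=
  (opnorm (@Num.norm R Y) (@l2norm R) W T *
   opnorm (@l2norm R) (@Num.norm R Y) setT S)%E.

(** Both operator norms are positive, as [w] and [T w] are nonzero; hence a finite product forces
    both factors to be finite. *)
Lemma distortion_bounds W T S w : is_subspace W -> lin_iso_l2 W T S ->
    W w -> w != 0 -> distortion W T S != +oo%E ->
  exists a b, [/\ 0 <= a, 0 <= b, distortion W T S = (a * b)%:E,
    forall x, W x -> l2norm (T x) <= a * `|x| &
    forall x, W x -> `|x| <= b * l2norm (T x)].
Proof.
move=> /is_subspaceP[W0 WD] [TD WS ST TS] Ww w0.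
have WZ (a : R) x : W x -> W (a *: x).
  by move=> Wx; rewrite -[_ *: _]addr0; exact: WD.
have T0 : T 0 = 0.
  have := TD 1 0 0 W0 W0; rewrite scaler0 addr0 scale1r => /eqP.
  by rewrite -subr_eq0 opprD addNKr oppr_eq0 => /eqP.
have TZ (a : R) x : W x -> T (a *: x) = a *: T x.
  by move=> Wx; rewrite -[_ *: x]addr0 TD // T0 addr0.
have SZ (a : R) x : S (a *: x) = a *: S x.
  by rewrite -[in LHS](TS x) -TZ // ST //; exact: WZ.
have leT x : W x -> ((l2norm (T x))%:E <=
    opnorm (@Num.norm R Y) (@l2norm R) W T * `|x|%:E)%E.
  by apply: le_opnorm => //; [exact: normr0_eq0|exact: normrZ|exact: l2normZ].
have leS x : (`|S x|%:E <=
    opnorm (@l2norm R) (@Num.norm R Y) setT S * (l2norm x)%:E)%E.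
  by apply: le_opnorm => //; [exact: l2norm_ge0|exact: l2norm_eq0|
    exact: l2normZ|exact: normrZ].
have Tw : 0 < l2norm (T w).
  rewrite lt_def l2norm_ge0 andbT; apply: contra_neq w0 => /l2norm_eq0 Tw.
  by rewrite -(ST w Ww) Tw -(scale0r (0 : 'rV[R]_2)) SZ scale0r.
have opT : (0 < opnorm (@Num.norm R Y) (@l2norm R) W T)%E.
  by apply: opnorm_gt0 Ww Tw => //;
    [exact: normr0_eq0|exact: normrZ|exact: l2normZ].
have opS : (0 < opnorm (@l2norm R) (@Num.norm R Y) setT S)%E.
  apply: (@opnorm_gt0 _ _ _ _ _ _ _ _ _ _ _ _ _ (T w)) => //;
    by [exact: l2norm_ge0|exact: l2norm_eq0|exact: l2normZ|exact: normrZ|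
      rewrite ST // normr_gt0].
rewrite /distortion; move: opT opS leT leS.
case: (opnorm _ _ W T) => [a||] //; case: (opnorm _ _ setT S) => [b||] //;
  rewrite ?lte_fin => a0 b0 leT leS; rewrite ?gt0_mulye ?gt0_muley ?lte_fin //.
move=> _; exists a, b; split; rewrite ?(ltW a0) ?(ltW b0) //.
by move=> x Wx; rewrite -lee_fin EFinM -{1}(ST x Wx); exact: leS.
Qed.

(** Going to the plane and back gives [|w| <= b * |T w| <= a * b * |w|]. *)
Lemma distortion_ge1 W T S w : is_subspace W -> lin_iso_l2 W T S ->
  W w -> w != 0 -> (1 <= distortion W T S)%E.
Proof.
move=> sW iso Ww w0; have [->|fin] := eqVneq (distortion W T S) +oo%E.
  by rewrite leey.
have [a [b [a0 b0 -> leT leS]]] := distortion_bounds sW iso Ww w0 fin.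
rewrite lee_fin -(@ler_pM2r _ `|w|) ?normr_gt0 // mul1r.
apply: (le_trans (leS _ Ww)).
by rewrite [a * b]mulrC -mulrA ler_wpM2l // leT.
Qed.

Lemma norm_gt0_proximal (u v : Y) :
  u != 0 -> (forall t : R, `|v - u| <= `|v - t *: u|) -> 0 < `|v|.
Proof.
move=> u0 best; rewrite normr_gt0; apply: contra_neq u0 => v0.
have := best 0; rewrite v0 scale0r subr0 sub0r normrN normr0.
by rewrite normr_le0 => /eqP.
Qed.

(** Here [u] is the best approximation and [v] the vector approximated, so that the error is
    [v - u]. *)
Lemma distortion_sqr_ge W T S u v : is_subspace W -> lin_iso_l2 W T S ->
    W u -> W v -> u != 0 -> u != v -> (forall t, `|v - u| <= `|v - t *: u|) ->
  (`|u|%:E <= distortion W T S ^+ 2 * `|v|%:E)%E.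
Proof.
move=> sW iso Wu Wv u0 uv best.
have [Woo|fin] := eqVneq (distortion W T S) +oo%E.
  have v0 : 0 < `|v| := norm_gt0_proximal u0 best.
  by rewrite Woo expe2 mulyy gt0_mulye ?lte_fin // leey.
have [a [b [a0 b0 -> leT leS]]] := distortion_bounds sW iso Wu u0 fin.
case: iso => TD WS ST TS; case/is_subspaceP: (sW) => W0 WD.
have Wsub t : W (v - t *: u) by rewrite addrC -scaleNr; exact: WD.
have Tsub t : T (v - t *: u) = T v - t *: T u.
  by rewrite addrC -scaleNr TD // scaleNr addrC.
have Tpos x : W x -> x != 0 -> 0 < l2norm (T x).
  move=> Wx x0; rewrite lt_def l2norm_ge0 andbT.
  apply: contra_neq x0 => Tx; apply/eqP; rewrite -normr_le0.
  by have := leS _ Wx; rewrite Tx mulr0.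
have Tu0 : T u != 0.
  apply: contraTneq (Tpos _ Wu u0) => ->.
  by rewrite -(scale0r (0 : 'rV[R]_2)) l2normZ normr0 mul0r ltxx.
have [t ht] := l2norm_height_le (T v) Tu0.
have Wvu : W (v - u) by rewrite -[u]scale1r.
have Tvu : T (v - u) = T v - T u by rewrite -{1}[u]scale1r Tsub scale1r.
(* Minimality of the error passes to the plane up to the factor [a * b]: [|T (v - u)| <= a * |v - u|
   <= a * |v - t *: u| <= a * b * |T (v - t *: u)|]. *)
have h1 : l2norm (T v - T u) <= a * b * l2norm (T v - t *: T u).
  rewrite -Tvu; apply: (le_trans (leT _ Wvu)).
  rewrite -mulrA ler_wpM2l //; apply: (le_trans (best t)).
  by rewrite -Tsub; exact: leS.
have h2 : l2norm (T u) <= a * b * l2norm (T v).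
  (* After multiplication by this length, positive since [u != v], [h1] applies first and then the
     area inequality [ht]. *)
  rewrite -(@ler_pM2l _ (l2norm (T v - T u))); last first.
    by rewrite -Tvu Tpos // subr_eq0 eq_sym.
  apply: (@le_trans _ _ (a * b * (l2norm (T v - t *: T u) * l2norm (T u)))).
    by rewrite mulrA ler_wpM2r // l2norm_ge0.
  by rewrite [leRHS]mulrCA ler_wpM2l // mulr_ge0.
rewrite expe2 -!EFinM lee_fin; apply: (le_trans (leS _ Wu)).
apply: (@le_trans _ _ (b * (a * b * (a * `|v|)))).
  by rewrite ler_wpM2l // (le_trans h2) // ler_wpM2l ?mulr_ge0 // leT.
by rewrite le_eqVlt; apply/orP; left; apply/eqP; ring.
Qed.

End Distortion.

(** * Passage to the infimum over isomorphisms and the supremum over planes *)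

Section BanachMazur.
Context {R : realType} {Y : normedModType R}.
Implicit Types (u v : Y) (W : set Y).

Lemma lin_indep2_neq0 u v : lin_indep2 u v -> u != 0.
Proof.
move=> uv; apply/eqP => u0.
have [] := uv 1 0; first by rewrite u0 scaler0 scale0r addr0.
by move/eqP; rewrite oner_eq0.
Qed.

Definition plane u v : set Y := [set w | exists a b, w = a *: u + b *: v].

Lemma plane_left u v : plane u v u.
Proof. by exists 1, 0; rewrite scale1r scale0r addr0. Qed.

Lemma plane_right u v : plane u v v.
Proof. by exists 0, 1; rewrite scale1r scale0r add0r. Qed.

Lemma is_subspace_plane u v : is_subspace (plane u v).
Proof.
apply/is_subspaceP; split; first by exists 0, 0; rewrite !scale0r addr0.
move=> c _ _ [a [b ->]] [a' [b' ->]]; exists (c * a + a'), (c * b + b').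
by rewrite scalerDr !scalerA !scalerDl addrACA.
Qed.

Lemma dim_eq2_plane u v : lin_indep2 u v -> dim_eq2 (plane u v).
Proof.
by move=> uv; exists u, v; split=> //; [exact: plane_left|exact: plane_right].
Qed.

Lemma dBM_l2_ge1 W : is_subspace W -> dim_eq2 W -> (1 <= dBM_l2 W)%E.
Proof.
move=> sW [u [v [Wu _ uv _]]]; apply: le_ereal_inf_tmp => _ [T [S [iso ->]]].
exact: distortion_ge1 sW iso Wu (lin_indep2_neq0 uv).
Qed.

Lemma dBM_l2_sqr_le_CBM W : is_subspace W -> dim_eq2 W ->
  (dBM_l2 W ^+ 2 <= CBM Y)%E.
Proof. by move=> sW dW; apply: ereal_sup_ubound; exists W. Qed.

(** Two independent vectors span a plane, so the supremum runs over a nonempty set of numbers that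
    are at least 1. *)
Lemma CBM_ge1 : dim_ge2 Y -> (1 <= CBM Y)%E.
Proof.
move=> [u [v uv]].
have sW := is_subspace_plane u v; have dW := dim_eq2_plane uv.
apply: le_trans (dBM_l2_sqr_le_CBM sW dW).
by rewrite expe2 -[1%E]mule1 lee_pmul // dBM_l2_ge1.
Qed.

Lemma dBM_l2_sqr_ge W u v : is_subspace W -> W u -> W v ->
    u != 0 -> u != v -> (forall t, `|v - u| <= `|v - t *: u|) ->
  (`|u|%:E <= dBM_l2 W ^+ 2 * `|v|%:E)%E.
Proof.
move=> sW Wu Wv u0 uv best.
have v0 : 0 < `|v| := norm_gt0_proximal u0 best.
(* The infimum is taken before squaring, so the bound is put as a lower bound [r] for each
   distortion. *)
set r := Num.sqrt (`|u| / `|v|).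
have r2 : r ^+ 2 = `|u| / `|v| by rewrite sqr_sqrtr // divr_ge0.
suff rd : (r%:E <= dBM_l2 W)%E.
  rewrite -lee_pdivrMr // -EFinM -r2 expr2 expe2 EFinM.
  by apply: lee_pmul; rewrite ?lee_fin ?sqrtr_ge0.
apply: le_ereal_inf_tmp => _ [T [S [iso ->]]]; rewrite -/(distortion W T S).
have := distortion_sqr_ge sW iso Wu Wv u0 uv best.
(* This excludes the value [-oo] and gives the sign needed to compare [r] and [d] through their
   squares. *)
have := distortion_ge1 sW iso Wu u0.
case: (distortion W T S) => [d||] //; last by move=> _ _; rewrite leey.
rewrite expe2 -!EFinM !lee_fin => d1 ud.
rewrite -(@ler_pXn2r _ 2) ?nnegrE ?sqrtr_ge0 ?(le_trans ler01) //.
by rewrite r2 ler_pdivrMr // expr2.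
Qed.

End BanachMazur.

Theorem proposition2p11 (R : realType) (Y : completeNormedModType R)
    (hY : dim_ge2 Y) (M : set Y) (hM : is_subspace M) (hMc : closed M)
    (y y0 : Y) (hy0 : best_approx M y y0) :
  (`|y0|%:E <= CBM Y * `|y|%:E)%E.
Proof.
have C1 := CBM_ge1 hY.
case: hy0 => My0 best; case/is_subspaceP: hM => M0 MD.
have MZ (t : R) x : M x -> M (t *: x).
  by move=> Mx; rewrite -[_ *: _]addr0; exact: MD.
(* If [y] lies in [M], then [y0 = y] and [1 <= CBM Y] suffices. *)
have [My|nMy] := pselect (M y).
  have := best y My; rewrite subrr normr0 normr_le0 subr_eq0 => /eqP <-.
  by rewrite -[leLHS]mul1e lee_wpmul2r // lee_fin.
have [->|y00] := eqVneq y0 0.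
  by rewrite normr0 mule_ge0 ?lee_fin // (le_trans _ C1) // lee_fin.
have ind : lin_indep2 y0 y.
  (* A relation with [b != 0] would make [y] a multiple of [y0], hence an element of [M]. *)
  move=> a b /eqP; have [->|b0] := eqVneq b 0.
    by rewrite scale0r addr0 scaler_eq0 (negbTE y00) orbF => /eqP.
  rewrite addr_eq0 => /eqP ab; case: nMy.
  have -> : y = - (b^-1 * a) *: y0.
    by rewrite scaleNr -scalerA ab scalerN opprK scalerA mulVf // scale1r.
  exact: MZ.
have sW := is_subspace_plane y0 y.
apply: (@le_trans _ _ (dBM_l2 (plane y0 y) ^+ 2 * `|y|%:E)%E).
  (* Of the approximation property only the competitors [t *: y0], which lie in [M], enter. *)
  apply: dBM_l2_sqr_ge => //; [exact: plane_left|exact: plane_right| |].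
    by apply/eqP => yy0; apply: nMy; rewrite -yy0.
  by move=> t; apply: best; exact: MZ.
rewrite lee_wpmul2r ?lee_fin // dBM_l2_sqr_le_CBM //; exact: dim_eq2_plane.
Qed.
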